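(* Let $\mathbf P=(P,\leq,{}',0,1)$ be a complemented poset with antitone complementation and $F$ a filter and $I$ an ideal of $\mathbf P$. Then the following hold: (i) Assume $x\leq x''$ for all $x\in P$. Then $F_0$ is a c-ideal of $\mathbf P$. (ii) Assume $x''\leq x$ for all $x\in P$. Then $I_0$ is a c-filter of $\mathbf P$.
   Context: For a poset $(P,\leq)$ and $A\subseteq P$ put $L(A)=\{x\in P\mid x\leq y\text{ for all }y\in A\}$ and $U(A)=\{x\in P\mid y\leq x\text{ for all }y\in A\}$; write $L(a)=L(\{a\})$, $L(a,b)=L(\{a,b\})$, and similarly for $U$. A complemented poset $\mathbf P=(P,\leq,{}',0,1)$ is a bounded poset (bottom $0$, top $1$) with a unary operation ${}'$ (the complementation) such that for every $x\in P$ the join $x\vee x'$ and the meet $x\wedge x'$ exist and $x\vee x'=1$, $x\wedge x'=0$. The operation ${}'$ is antitone if $x\leq y$ implies $y'\leq x'$. Write $x''=(x')'$. For $A\subseteq P$ put $A_0=\{x\in P\mid x'\in A\}$. A non-empty subset $I$ of $P$ is an ideal of $\mathbf P$ if $L(x)\subseteq I$ and $U(x,y)\cap I\neq\emptyset$ for all $x,y\in I$. A non-empty subset $F$ of $P$ is a filter of $\mathbf P$ if $U(x)\subseteq F$ and $L(x,y)\cap F\neq\emptyset$ for all $x,y\in F$. An ideal $J$ of $\mathbf P$ is a c-ideal if there exists some filter $G$ of $\mathbf P$ with $G_0=J$. A filter $G$ of $\mathbf P$ is a c-filter if there exists some ideal $J$ of $\mathbf P$ with $J_0=G$. *)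

(* Defs.v *)
From mathcomp Require Import all_boot all_order.
From mathcomp Require Import classical_sets.

Set Implicit Arguments.
Unset Strict Implicit.
Unset Printing Implicit Defensive.

Local Open Scope classical_set_scope.
Local Open Scope order_scope.

(* U(A) and L(A) are the library's [ubound A] and [lbound A], so U(x, y) is
   [ubound [set x; y]]; for a complementation [c], A_0 is the preimage
   [c @^-1` A]. *)

(* [supremums A s] (resp. [infimums A s]) says that s is the least upper bound
   (resp. greatest lower bound) of A: only these joins and meets need exist. *)
Definition complementation d (P : tbPOrderType d) (c : P -> P) : Prop :=
  forall x : P,
    supremums [set x; c x] \top /\ infimums [set x; c x] \bot.

Definition antitone d (P : porderType d) (c : P -> P) : Prop :=
  {homo c : x y /~ x <= y}.

Definition poset_ideal d (P : porderType d) (I : set P) : Prop :=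
  I !=set0 /\
  forall x y : P, I x -> I y ->
    lbound [set x] `<=` I /\ ubound [set x; y] `&` I !=set0.

Definition poset_filter d (P : porderType d) (F : set P) : Prop :=
  F !=set0 /\
  forall x y : P, F x -> F y ->
    ubound [set x] `<=` F /\ lbound [set x; y] `&` F !=set0.

Definition c_ideal d (P : porderType d) (c : P -> P) (J : set P) : Prop :=
  poset_ideal J /\ exists2 G : set P, poset_filter G & c @^-1` G = J.

Definition c_filter d (P : porderType d) (c : P -> P) (G : set P) : Prop :=
  poset_filter G /\ exists2 J : set P, poset_ideal J & c @^-1` J = G.

(* Main.v *)
Require Import Defs.
From mathcomp Require Import all_boot all_order.
From mathcomp Require Import classical_sets.

Import Order.LTheory.

Local Open Scope classical_set_scope.
Local Open Scope order_scope.

(** An antitone map pulls back up-sets to down-sets.  If moreover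
    [x <= c (c x)], then [c] turns a lower bound [z] of [c x] and [c y] into an
    upper bound [c z] of [x] and [y], because [x <= c (c x) <= c z]; and [c z]
    lies in the preimage of a filter containing [z], because [z <= c (c z)].
    So the preimage of a filter is an ideal, and that filter witnesses that it
    is a c-ideal.  The second part is order dual. *)

Lemma poset_ideal_preimage d (P : porderType d) (c : P -> P) (F : set P) :
  antitone c -> (forall x, x <= c (c x)) -> poset_filter F ->
  poset_ideal (c @^-1` F).
Proof.
move=> c_anti le_cc [[f Ff] filterF].
have upF x y : F x -> x <= y -> F y.
  by move=> Fx xy; apply: (filterF x x Fx Fx).1 => _ ->.
split; first by exists (c f); exact: upF Ff (le_cc f).
move=> x y Fcx Fcy; split.
  by move=> z zx; apply: upF Fcx _; apply: c_anti; exact: zx.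
have [z [lbz Fz]] := (filterF _ _ Fcx Fcy).2.
exists (c z); split; last exact: upF Fz (le_cc z).
by move=> _ [] ->; apply: le_trans (le_cc _) _; apply: c_anti; apply: lbz;
  [left | right].
Qed.

Lemma poset_filter_preimage d (P : porderType d) (c : P -> P) (I : set P) :
  antitone c -> (forall x, c (c x) <= x) -> poset_ideal I ->
  poset_filter (c @^-1` I).
Proof.
move=> c_anti cc_le [[i Ii] idealI].
have downI x y : I x -> y <= x -> I y.
  by move=> Ix yx; apply: (idealI x x Ix Ix).1 => _ ->.
split; first by exists (c i); exact: downI Ii (cc_le i).
move=> x y Icx Icy; split.
  by move=> z xz; apply: downI Icx _; apply: c_anti; exact: xz.
have [z [ubz Iz]] := (idealI _ _ Icx Icy).2.
exists (c z); split; last exact: downI Iz (cc_le z).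
by move=> _ [] ->; apply: le_trans (cc_le _); apply: c_anti; apply: ubz;
  [left | right].
Qed.

Theorem theorem9 (d : Order.disp_t) (P : tbPOrderType d) (c : P -> P)
    (F I : set P)
    (c_compl : complementation c) (c_anti : antitone c)
    (filterF : poset_filter F) (idealI : poset_ideal I) :
  ((forall x : P, x <= c (c x)) -> c_ideal c (c @^-1` F)) /\
  ((forall x : P, c (c x) <= x) -> c_filter c (c @^-1` I)).
Proof.
split=> [le_cc | cc_le]; split.
- exact: poset_ideal_preimage.
- by exists F.
- exact: poset_filter_preimage.
- by exists I.
Qed.
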